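(* Let $E$ be an $n$-dimensional vector space over a field $\mathbb{F}$, and let $(E,\mathcal{I})$ be a $q$-matroid given by its collection of independent spaces, i.e. $\mathcal{I}\subseteq\mathcal{L}(E)$ satisfies (I1), (I2), (I3) and (I4). Then $\mathcal{I}$ satisfies the axiom (oI4) For all $A,B\in\mathcal{L}(E)$ and $I,J\in\mathcal{L}(E)$ such that $I\in\max(A,\mathcal{I})$ and $J\in\max(B,\mathcal{I})$, there exists $K\in\max(A+B,\mathcal{I})$ such that $K\subseteq I+J$.
   Context: $n$ is a positive integer, $\mathbb{F}$ is an arbitrary field, and $\mathcal{L}(E)$ denotes the lattice of all subspaces of $E$; for a subspace $A$, $\mathcal{L}(A)$ is the set of all subspaces of $A$. For a family $\mathcal{A}\subseteq\mathcal{L}(E)$, $\max(\mathcal{A})$ is the set of members of $\mathcal{A}$ that are maximal with respect to inclusion. For $X\in\mathcal{L}(E)$, $\max(X,\mathcal{A})$ is the set of members of $\mathcal{A}$ contained in $X$ that have the largest dimension among all members of $\mathcal{A}$ contained in $X$. Independence axioms for $\mathcal{I}\subseteq\mathcal{L}(E)$: (I1) $\mathcal{I}\neq\emptyset$. (I2) For all $I,J\in\mathcal{L}(E)$, if $J\in\mathcal{I}$ and $I\subseteq J$, then $I\in\mathcal{I}$. (I3) For all $I,J\in\mathcal{I}$ with $\dim I<\dim J$, there exists a $1$-dimensional subspace $x\subseteq J$, $x\not\subseteq I$, such that $I+x\in\mathcal{I}$. (I4) For all $A,B\in\mathcal{L}(E)$ and $I,J\in\mathcal{L}(E)$ such that $I\in\max(\mathcal{I}\cap\mathcal{L}(A))$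 and $J\in\max(\mathcal{I}\cap\mathcal{L}(B))$, there exists $K\in\max(\mathcal{I}\cap\mathcal{L}(A+B))$ such that $K\subseteq I+J$. *)

(* Defs.v *)
From HB Require Import structures.
From mathcomp Require Import all_boot all_order all_algebra.
From mathcomp Require Import classical_sets.

Set Implicit Arguments.
Unset Strict Implicit.
Unset Printing Implicit Defensive.

Import GRing.Theory.

Local Open Scope classical_set_scope.

Section QMatroid.
Variables (F : fieldType) (E : vectType F).
Implicit Types (X A B I J K U V x : {vspace E}) (S : set {vspace E}).

Definition subspaces X : set {vspace E} := [set U | (U <= X)%VS].

(* [max(S)]: maximality is for inclusion here, but by dimension in [max_dim X S],
   i.e. [max(X, S)]. *)
Definition max_incl S : set {vspace E} :=
  [set U | S U /\ forall V, S V -> (U <= V)%VS -> V = U].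

Definition max_dim X S : set {vspace E} :=
  [set U | (S `&` subspaces X) U /\
           forall V, (S `&` subspaces X) V -> (\dim V <= \dim U)%N].

Definition axiom_I1 S : Prop := S <> set0.

Definition axiom_I2 S : Prop :=
  forall I J, S J -> (I <= J)%VS -> S I.

Definition axiom_I3 S : Prop :=
  forall I J, S I -> S J -> (\dim I < \dim J)%N ->
  exists x, [/\ \dim x = 1%N, (x <= J)%VS, ~~ (x <= I)%VS & S (I + x)%VS].

Definition axiom_I4 S : Prop :=
  forall A B I J,
    max_incl (S `&` subspaces A) I -> max_incl (S `&` subspaces B) J ->
  exists2 K, max_incl (S `&` subspaces (A + B)%VS) K & (K <= I + J)%VS.

Definition axiom_oI4 S : Prop :=
  forall A B I J, max_dim A S I -> max_dim B S J ->
  exists2 K, max_dim (A + B)%VS S K & (K <= I + J)%VS.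

Definition qmatroid_independent S : Prop :=
  [/\ axiom_I1 S, axiom_I2 S, axiom_I3 S & axiom_I4 S].

End QMatroid.

(* Main.v *)
Require Import Defs.
From mathcomp Require Import all_boot all_order all_algebra.
From mathcomp Require Import classical_sets.

(** The axioms (I4) and (oI4) differ only in the meaning of maximality, by
    inclusion or by dimension, so it suffices that the two agree on the
    independent subspaces of a given space. A member of largest dimension is
    maximal for inclusion in any family of subspaces ([max_dim_max_incl]); the
    converse is where the matroid structure enters, through the augmentation
    axiom (I3) ([max_incl_max_dim]). (oI4) is then (I4), read through these two
    implications. *)

Local Open Scope classical_set_scope.

Lemma max_dim_max_incl (F : fieldType) (E : vectType F)
    (S : set {vspace E}) (X U : {vspace E}) :
  max_dim X S U -> max_incl (S `&` subspaces X) U.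
Proof.
move=> [SXU dim_max]; split=> // V SXV leUV.
by apply/esym/eqP; rewrite eqEdim leUV dim_max.
Qed.

(** A larger independent subspace of [X] would, by (I3), lend a line to [U];
    the augmented space is still independent and inside [X], against the
    maximality of [U]. *)
Lemma max_incl_max_dim (F : fieldType) (E : vectType F)
    (S : set {vspace E}) (X U : {vspace E}) :
  axiom_I3 S -> max_incl (S `&` subspaces X) U -> max_dim X S U.
Proof.
move=> I3 [[SU leUX] incl_max]; split=> // V [SV leVX].
rewrite leqNgt; apply/negP=> ltUV.
have [x [_ lexV /negP nlexU SUx]] := I3 U V SU SV ltUV.
have leUxX : (U + x <= X)%VS by rewrite subv_add leUX (subv_trans lexV leVX).
apply: nlexU.
by rewrite -(incl_max (U + x)%VS (conj SUx leUxX) (addvSl U x)) addvSr.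
Qed.

Theorem theorem15 (n : nat) (n_gt0 : (0 < n)%N) (F : fieldType)
    (E : vectType F) (dimE : \dim (fullv : {vspace E}) = n)
    (Ind : set {vspace E}) (IndP : qmatroid_independent Ind) :
  axiom_oI4 Ind.
Proof.
have [_ _ I3 I4] := IndP.
move=> A B I J /max_dim_max_incl maxI /max_dim_max_incl maxJ.
have [K maxK leKIJ] := I4 A B I J maxI maxJ.
by exists K => //; apply: max_incl_max_dim.
Qed.
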